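(* Let $R$ be a uniserial ring with only finitely many two-sided ideals. Then $\mathrm{Zg}_R/T_0$ is finite; that is, $\mathrm{Zg}_R$ has only finitely many points up to topological indistinguishability.
   Context: A ring is uniserial if its right ideals are totally ordered by inclusion and its left ideals are totally ordered by inclusion. Modules are right modules. A pp-$n$-formula is a formula $\exists\bar y\,(\bar y,\bar x)A=0$ with $A$ a matrix over $R$; $\varphi(M)$ is its solution set in $M$. A module $N$ is pure-injective if every pure-embedding (embedding reflecting solution sets of pp-formulae) out of $N$ splits. $\mathrm{Zg}_R$ is the space of isomorphism classes of indecomposable pure-injective right $R$-modules, with basis of open sets $(\varphi/\psi)=\{N:\varphi(N)\supsetneq\varphi(N)\cap\psi(N)\}$ for pp-$1$-formulae $\varphi,\psi$. Two points are topologically indistinguishable if they lie in the same open sets; for a space $T$, $T/T_0$ is the quotient space of $T$ by topological indistinguishability. *)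

(* Defs.v *)
From HB Require Import structures.
From mathcomp Require Import all_boot all_order all_algebra.
From mathcomp Require Import boolp classical_sets functions cardinality.

Set Implicit Arguments.
Unset Strict Implicit.
Unset Printing Implicit Defensive.

Import GRing.Theory.

Local Open Scope ring_scope.
Local Open Scope classical_set_scope.

Section Ideals.
Variable R : pzRingType.
Implicit Type I J : set R.

Definition right_ideal I :=
  [/\ I 0, forall x y, I x -> I y -> I (x + y)
    & forall x r, I x -> I (x * r)].

Definition left_ideal I :=
  [/\ I 0, forall x y, I x -> I y -> I (x + y)
    & forall r x, I x -> I (r * x)].

Definition two_sided_ideal I := right_ideal I /\ left_ideal I.

Definition uniserial :=
  (forall I J, right_ideal I -> right_ideal J -> I `<=` J \/ J `<=` I) /\
  (forall I J, left_ideal I -> left_ideal J -> I `<=` J \/ J `<=` I).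

End Ideals.

(* A right R-module is a left module over the converse ring R^c; the action
   v . r is written r *: v.  Ideals are closed under opposites since
   - x = x * (- 1) = (- 1) * x. *)
Notation rmodType R := (lmodType R^c).

Section PositivePrimitive.
Variable R : pzRingType.

(* The pp-n-formula  exists y, (y, x) A = 0, where y has length pp_bound. *)
Record pp_formula (n : nat) := PPFormula {
  pp_bound : nat;
  pp_eqns : nat;
  pp_mx : 'M[R]_(pp_bound + n, pp_eqns)
}.

Definition pp_sol (n : nat) (phi : pp_formula n) (M : rmodType R) :
    set 'rV[M]_n :=
  [set x | exists y : 'rV[M]_(pp_bound phi), forall j,
     \sum_i (pp_mx phi i j : R^c) *: row_mx y x 0 i = 0].
Arguments pp_sol {n} phi M.

Definition pure_embedding (M N : rmodType R) (f : {linear M -> N}) :=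
  injective f /\
  forall (n : nat) (phi : pp_formula n) (x : 'rV[M]_n),
    pp_sol phi N (map_mx f x) -> pp_sol phi M x.

Definition pure_injective (M : rmodType R) :=
  forall (N : rmodType R) (f : {linear M -> N}), pure_embedding f ->
    exists g : {linear N -> M}, cancel f g.

Definition submodule (M : rmodType R) (U : set M) :=
  [/\ U 0, forall u v, U u -> U v -> U (u + v)
    & forall (r : R^c) u, U u -> U (r *: u)].

Definition indecomposable (M : rmodType R) :=
  (exists v : M, v != 0) /\
  forall U V : set M, submodule U -> submodule V ->
    U `&` V = [set 0] ->
    (forall w : M, exists u v, [/\ U u, V v & w = u + v]) ->
    U = [set 0] \/ V = [set 0].

Definition isomorphic (M N : rmodType R) :=
  exists f : {linear M -> N}, bijective f.

End PositivePrimitive.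

Arguments pp_sol {R n} phi M.

(* The Ziegler spectrum is a collection of modules, hence lives in a universe
   above the carriers of lmodType, choiceType and topologicalType; the library
   theories of quotients, of finite sets and of topological spaces cannot be
   instantiated there.  What is needed is set up for an arbitrary Type below,
   with T -> Prop in place of the small type set T. *)
Section LargeTypes.
Variable T : Type.

(* The quotient of T by E, for E an equivalence relation. *)
Definition classes (E : T -> T -> Prop) :=
  {C : T -> Prop | exists x, C = E x}.

Definition to_class (E : T -> T -> Prop) (x : T) : classes E :=
  exist _ (E x) (ex_intro _ x erefl).

Definition finite_type := exists (n : nat) (f : 'I_n -> T),
  forall x, exists i, f i = x.

Definition is_topology (O : (T -> Prop) -> Prop) :=
  [/\ O (fun=> True),
      forall U V, O U -> O V -> O (fun x => U x /\ V x)
    & forall F : (T -> Prop) -> Prop, (forall U, F U -> O U) ->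
        O (fun x => exists2 U, F U & U x)].

End LargeTypes.

Record space := Space {
  space_pt :> Type;
  open_in : (space_pt -> Prop) -> Prop;
  open_in_topology : is_topology open_in
}.

(* The coarsest topology containing B. *)
Definition generated_open (T : Type) (B : (T -> Prop) -> Prop) (U : T -> Prop) :=
  forall O, is_topology O -> (forall V, B V -> O V) -> O U.

Lemma generated_topology (T : Type) (B : (T -> Prop) -> Prop) :
  is_topology (generated_open B).
Proof.
split=> [O OT _ | U V oU oV O OT BO | F oF O OT BO]; have [O1 OI OU] := OT.
- exact: O1.
- by apply: OI; [exact: oU | exact: oV].
- by apply: OU => U FU; exact: oF.
Qed.

Section KolmogorovQuotient.
Variable T : space.

Definition indistinguishable (x y : T) :=
  forall U, open_in U -> (U x <-> U y).

Definition T0_open (W : classes indistinguishable -> Prop) :=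
  open_in (fun x => W (to_class indistinguishable x)).

Lemma T0_topology : is_topology T0_open.
Proof.
have [O1 OI OU] := open_in_topology T.
split=> [|U V|F oF]; [exact: O1 | exact: OI |].
pose G (V : T -> Prop) :=
  exists2 W, F W & V = (fun x => W (to_class indistinguishable x)).
rewrite /T0_open; have -> :
    (fun x => exists2 W, F W & W (to_class indistinguishable x))
    = (fun x => exists2 V, G V & V x).
  apply/funext => x; apply/propext; split=> [[W FW Wx]|[_ [W FW ->] Wx]].
    by exists (fun x => W (to_class indistinguishable x)) => //; exists W.
  by exists W.
by apply: OU => _ [W FW ->]; exact: oF.
Qed.

Definition T0_quotient := Space T0_topology.

End KolmogorovQuotient.

Section ZieglerSpectrum.
Variable R : pzRingType.

Record indec_pinj := IndecPinj {
  indec_pinj_mod :> rmodType R;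
  indec_pinjP : pure_injective indec_pinj_mod;
  indec_pinj_indec : indecomposable indec_pinj_mod
}.

Definition Zg_point := classes (fun M N : indec_pinj => isomorphic M N).

(* The set (phi / psi); its defining condition is invariant under isomorphism. *)
Definition Zg_basic (phi psi : pp_formula R 1) (C : Zg_point) :=
  exists2 N : indec_pinj, sval C N &
    pp_sol phi N `&` pp_sol psi N `<` pp_sol phi N.

(* The sets (phi / psi) are a basis of open sets by a theorem of Ziegler, so
   the topology they generate consists of their unions. *)
Definition Zg_open : (Zg_point -> Prop) -> Prop :=
  generated_open (fun U => exists phi psi, U = Zg_basic phi psi).

Definition Zg := Space (generated_topology _ : is_topology Zg_open).

End ZieglerSpectrum.

(* Main.v *)
(* Write N s for the image and ann h for the kernel of multiplication by s, h in
   a module N. Over a uniserial ring systems of linear equations can be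
   diagonalised, so every pp-1-formula is a finite sum of formulas
   "s | x and x h = 0".
   If N is indecomposable pure-injective, any N s and ann h are comparable: for
   a in N s \ ann h and b in ann h \ N s, distributivity and pure-injectivity
   show that the semigroup of endomorphisms f with f a - a and f b in
   N s `&` ann h is not empty; it is compact in the sense of limits along
   filters, so it contains an idempotent, which splits N. Hence the pp-subgroups
   of N form a chain, and it remains to control the equality N s = ann h.
   The elements annihilating N, acting non-injectively, or acting
   non-surjectively form two-sided ideals A, P, Q. If N s = ann h and
   s' = a s b with a left invertible, then N s' = ann h' as soon as this holds in
   some N' with the same A, P, Q; since the elements a s b form the two-sided
   ideal generated by s, the topological type of N depends only on A, P, Q and a
   set of two-sided ideals. *)
Require Import Defs.
From HB Require Import structures.
From mathcomp Require Import all_boot all_order all_algebra.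
From mathcomp Require Import boolp classical_sets functions cardinality.

Set Implicit Arguments.
Unset Strict Implicit.
Unset Printing Implicit Defensive.

Import GRing.Theory.

Local Open Scope ring_scope.
Local Open Scope classical_set_scope.

(** * Linear systems over uniserial rings *)

Section RightAction.
Variables (R : pzRingType) (M : rmodType R).

(** The scalar is typed in [R] and written on the right, so that products of scalars are read in the
    order of [R] and not of [R^c]. *)
Definition act (u : M) (r : R) : M := (r : R^c) *: u.

Lemma actM u r s : act u (r * s) = act (act u r) s.
Proof. by rewrite /act scalerA. Qed.

Lemma act1 u : act u 1 = u.
Proof. exact: scale1r. Qed.

Lemma act0 u : act u 0 = 0.
Proof. exact: scale0r. Qed.

Lemma act0l r : act 0 r = 0.
Proof. exact: scaler0. Qed.

Lemma actDr u r s : act u (r + s) = act u r + act u s.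
Proof. exact: scalerDl. Qed.

Lemma actDl u v r : act (u + v) r = act u r + act v r.
Proof. exact: scalerDr. Qed.

Lemma actNr u r : act u (- r) = - act u r.
Proof. exact: scaleNr. Qed.

Lemma actNl u r : act (- u) r = - act u r.
Proof. exact: scalerN. Qed.

Lemma actBr u r s : act u (r - s) = act u r - act u s.
Proof. by rewrite actDr actNr. Qed.

Lemma actBl u v r : act (u - v) r = act u r - act v r.
Proof. by rewrite actDl actNl. Qed.

Lemma act_suml (I : Type) (s : seq I) (P : pred I) (F : I -> M) r :
  act (\sum_(i <- s | P i) F i) r = \sum_(i <- s | P i) act (F i) r.
Proof. exact: scaler_sumr. Qed.

Lemma act_sum_delta n (u : 'I_n -> M) (k : 'I_n) :
  \sum_i act (u i) (i == k)%:R = u k.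
Proof.
rewrite (bigD1 k) //= eqxx act1 big1 ?addr0 // => i /negbTE ->.
exact: act0.
Qed.

Definition act_im (s : R) : set M := [set x | exists u, x = act u s].

Definition act_ker (h : R) : set M := [set x | act x h = 0].

End RightAction.

Arguments act_im {R} M s.
Arguments act_ker {R} M h.

Section UniserialDivisibility.
Variable R : pzRingType.
Hypothesis uniR : uniserial R.

Lemma uniserial_rdvd (a b : R) : (exists z, b = a * z) \/ (exists z, a = b * z).
Proof.
have rI (c : R) : right_ideal [set x | exists z, x = c * z].
  split=> [|x y [u ->] [v ->]|x r [u ->]].
  - by exists 0; rewrite mulr0.
  - by exists (u + v); rewrite mulrDr.
  - by exists (u * r); rewrite mulrA.
have self (c : R) : exists z, c = c * z by exists 1; rewrite mulr1.
by have [ab|ba] := uniR.1 _ _ (rI a) (rI b); [right; exact: ab|left; exact: ba].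
Qed.

Lemma uniserial_ldvd (a b : R) : (exists z, b = z * a) \/ (exists z, a = z * b).
Proof.
have lI (c : R) : left_ideal [set x | exists z, x = z * c].
  split=> [|x y [u ->] [v ->]|r x [u ->]].
  - by exists 0; rewrite mul0r.
  - by exists (u + v); rewrite mulrDl.
  - by exists (r * u); rewrite mulrA.
have self (c : R) : exists z, c = z * c by exists 1; rewrite mul1r.
by have [ab|ba] := uniR.2 _ _ (lI a) (lI b); [right; exact: ab|left; exact: ba].
Qed.

End UniserialDivisibility.

(** Stated for total preorders, since divisibility is not antisymmetric. *)
Lemma ord_max_elt (T : Type) (le : T -> T -> Prop) n (c : 'I_n.+1 -> T) :
  (forall x y, le x y \/ le y x) ->
  (forall x y z, le x y -> le y z -> le x z) ->
  exists i, forall j, le (c j) (c i).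
Proof.
move=> tot tr; elim: n c => [|n IHn] c.
  by exists ord0 => j; rewrite (ord1 j); case: (tot (c ord0) (c ord0)).
have [i maxi] := IHn (c \o lift ord0).
case: (tot (c ord0) (c (lift ord0 i))) => h.
  exists (lift ord0 i) => j; case: (unliftP ord0 j) => [k ->|-> //].
  exact: maxi.
exists ord0 => j; case: (unliftP ord0 j) => [k ->|->].
  exact: tr (maxi k) h.
by case: (tot (c ord0) (c ord0)).
Qed.

Lemma ord_extend (T : Type) n (i : 'I_n.+1) (x : T) (u : 'I_n -> T) :
  exists2 v : 'I_n.+1 -> T, v i = x & forall j, v (lift i j) = u j.
Proof.
exists (fun k => if unlift i k is Some j then u j else x).
  by rewrite unlift_none.
by move=> j; rewrite liftK.
Qed.

Section NormalForm.
Variable R : pzRingType.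
Hypothesis uniR : uniserial R.

(* Elimination: if every d i is c i * e i, choose c i0 left-maximal, say
   c j = r j * c i0; replacing u i0 by v := u i0 + sum_j u j * r j turns the
   equation into v * c i0 = 0, and u i0 * d i0 = 0 into an equation for the
   remaining variables. *)
Lemma impose_equation n (K : Type) (d c : 'I_n -> R) (p : 'I_n -> K -> R) :
  exists n' (d' : 'I_n' -> R) (p' : 'I_n' -> K -> R),
  forall (M : rmodType R) (w : K -> M),
    (exists u : 'I_n -> M, [/\ forall i, act (u i) (d i) = 0,
       \sum_i act (u i) (c i) = 0 & forall k, w k = \sum_i act (u i) (p i k)])
    <->
    (exists u : 'I_n' -> M, (forall i, act (u i) (d' i) = 0) /\
       forall k, w k = \sum_i act (u i) (p' i k)).
Proof.
elim: n d c p => [|n IHn] d c p.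
  exists 0%N, d, p => M w; split=> -[u].
    by case=> ? _ ?; exists u.
  by case=> ? ?; exists u; split=> //; rewrite big_ord0.
(* Here [u i0 * c i0] vanishes because [u i0 * d i0] does: the variable [i0] drops out of the
   equation and is carried along unchanged. *)
have [[i0 [e ce]]|nodvd] := pselect (exists i0, exists e, c i0 = d i0 * e).
  have [n' [d' [p' H]]] :=
    IHn (d \o lift i0) (c \o lift i0) (fun j => p (lift i0 j)).
  have [d1 d10 d1l] := ord_extend ord0 (d i0) d'.
  have [p1 p10 p1l] := ord_extend ord0 (p i0) p'.
  exists n'.+1, d1, p1 => M w.
  split=> [[u [ud uc uw]]|[u [ud uw]]].
    have uc0 : act (u i0) (c i0) = 0 by rewrite ce actM ud act0l.
    have /H[v [vd vw]] : exists v : 'I_n -> M,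
        [/\ forall j, act (v j) ((d \o lift i0) j) = 0,
            \sum_j act (v j) ((c \o lift i0) j) = 0 &
            forall k, w k - act (u i0) (p i0 k) =
                      \sum_j act (v j) (p (lift i0 j) k)].
      exists (u \o lift i0); split=> [j||k]; first exact: ud.
        by move: uc; rewrite (bigD1_ord i0) //= uc0 add0r.
      by rewrite uw (bigD1_ord i0) //= addrAC subrr add0r.
    have [v1 v10 v1l] := ord_extend ord0 (u i0) v.
    exists v1; split=> [j|k].
      case: (unliftP ord0 j) => [j' ->|->]; first by rewrite v1l d1l.
      by rewrite v10 d10.
    rewrite (bigD1_ord ord0) //= v10 p10.
    under eq_bigr do rewrite v1l p1l.
    by rewrite -vw addrC subrK.
  have /H[v [vd vc vw]] : exists v : 'I_n' -> M,
      (forall i, act (v i) (d' i) = 0) /\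
      forall k, w k - act (u ord0) (p i0 k) = \sum_j act (v j) (p' j k).
    exists (u \o lift ord0); split=> [j|k]; first by rewrite -d1l ud.
    rewrite uw (bigD1_ord ord0) //= p10 addrAC subrr add0r.
    by under eq_bigr do rewrite p1l.
  have [v1 v10 v1l] := ord_extend i0 (u ord0) v.
  exists v1; split=> [j||k].
  - case: (unliftP i0 j) => [j' ->|->]; first by rewrite v1l; exact: vd.
    by rewrite v10 -d10.
  - rewrite (bigD1_ord i0) //= v10 ce actM -d10 ud act0l add0r.
    by under eq_bigr do rewrite v1l.
  - rewrite (bigD1_ord i0) //= v10.
    under eq_bigr do rewrite v1l.
    by rewrite -vw addrC subrK.
have /choice[e de] i : exists e, d i = c i * e.
  by case: (uniserial_rdvd uniR (c i) (d i)) => // ?; case: nodvd; exists i.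
have [i0 i0max] : exists i0, forall j, exists z, c j = z * c i0.
  apply: (ord_max_elt (le := fun x y => exists z, x = z * y)).
    by move=> x y; case: (uniserial_ldvd uniR x y); tauto.
  by move=> x y z [a ->] [b ->]; exists (a * b); rewrite mulrA.
have [r cr] := choice i0max.
have [n' [d' [p' H]]] := IHn (d \o lift i0) (fun j => r (lift i0 j) * d i0)
  (fun j k => p (lift i0 j) k - r (lift i0 j) * p i0 k).
have [d1 d10 d1l] := ord_extend ord0 (c i0) d'.
have [p1 p10 p1l] := ord_extend ord0 (p i0) p'.
exists n'.+1, d1, p1 => M w.
split=> [[u [ud uc uw]]|[u [ud uw]]].
  pose s := \sum_j act (u (lift i0 j)) (r (lift i0 j)).
  have vc : act (u i0 + s) (c i0) = 0.
    move: uc; rewrite (bigD1_ord i0) //= => <-.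
    rewrite actDl act_suml; congr (_ + _).
    by apply: eq_bigr => j _; rewrite (cr (lift i0 j)) actM.
  have /H[v [vd vw]] : exists v : 'I_n -> M,
      [/\ forall j, act (v j) ((d \o lift i0) j) = 0,
          \sum_j act (v j) (r (lift i0 j) * d i0) = 0 &
          forall k, w k - act (u i0 + s) (p i0 k) =
            \sum_j act (v j) (p (lift i0 j) k - r (lift i0 j) * p i0 k)].
    exists (u \o lift i0); split=> [j||k]; first exact: ud.
      under eq_bigr do rewrite actM.
      rewrite -act_suml -/s.
      have : act (u i0 + s) (d i0) = 0 by rewrite de actM vc act0l.
      by rewrite actDl ud add0r.
    under eq_bigr do rewrite actBr actM.
    rewrite sumrB -act_suml -/s uw (bigD1_ord i0) //= actDl.
    by rewrite opprD addrACA subrr add0r.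
  have [v1 v10 v1l] := ord_extend ord0 (u i0 + s) v.
  exists v1; split=> [j|k].
    case: (unliftP ord0 j) => [j' ->|->]; first by rewrite v1l d1l.
    by rewrite v10 d10.
  rewrite (bigD1_ord ord0) //= v10 p10.
  under eq_bigr do rewrite v1l p1l.
  by rewrite -vw addrC subrK.
have /H[v [vd vc vw]] : exists v : 'I_n' -> M,
    (forall i, act (v i) (d' i) = 0) /\
    forall k, w k - act (u ord0) (p i0 k) = \sum_j act (v j) (p' j k).
  exists (u \o lift ord0); split=> [j|k]; first by rewrite -d1l ud.
  rewrite uw (bigD1_ord ord0) //= p10 addrAC subrr add0r.
  by under eq_bigr do rewrite p1l.
pose s := \sum_j act (v j) (r (lift i0 j)).
have sd : act s (d i0) = 0.
  by rewrite act_suml -[RHS]vc; apply: eq_bigr => j _; rewrite actM.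
have [v1 v10 v1l] := ord_extend i0 (u ord0 - s) v.
exists v1; split=> [j||k].
- case: (unliftP i0 j) => [j' ->|->]; first by rewrite v1l; exact: vd.
  by rewrite v10 actBl sd subr0 de -d10 actM ud act0l.
- rewrite (bigD1_ord i0) //= v10 actBl -d10 ud sub0r d10 act_suml.
  under [X in _ + X]eq_bigr do rewrite v1l cr actM.
  exact: addNr.
- rewrite (bigD1_ord i0) //= v10.
  under eq_bigr do rewrite v1l.
  have := vw k; under [X in _ = X -> _]eq_bigr do rewrite actBr actM.
  rewrite sumrB -act_suml -/s actBl => /eqP.
  rewrite subr_eq => /eqP ->.
  by rewrite [RHS]addrC [RHS]addrCA [RHS]addrC.
Qed.

(** The equations are imposed one at a time; after each of them only one annihilation condition per
    variable remains. The induction allows such conditions [d] from the start and is applied with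
    [d = 0]. *)
Lemma linear_system_normal_form n m (a : 'I_n -> 'I_m -> R) (q : 'I_n -> R) :
  exists n' (d p : 'I_n' -> R), forall (M : rmodType R) (x : M),
    (exists u : 'I_n -> M, (forall j, \sum_i act (u i) (a i j) = 0) /\
       x = \sum_i act (u i) (q i)) <->
    (exists u : 'I_n' -> M, (forall i, act (u i) (d i) = 0) /\
       x = \sum_i act (u i) (p i)).
Proof.
suff gen (d : 'I_n -> R) : exists n' (d' p : 'I_n' -> R),
    forall (M : rmodType R) (x : M),
    (exists u : 'I_n -> M, [/\ forall i, act (u i) (d i) = 0,
       (forall j, \sum_i act (u i) (a i j) = 0) &
       x = \sum_i act (u i) (q i)]) <->
    (exists u : 'I_n' -> M, (forall i, act (u i) (d' i) = 0) /\
       x = \sum_i act (u i) (p i)).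
  have [n' [d' [p H]]] := gen (fun=> 0).
  exists n', d', p => M x; rewrite -H; split=> -[u].
    by case=> ? ?; exists u; split=> // i; rewrite act0.
  by case=> ? ? ?; exists u.
elim: m n a q d => [|m IHm] n a q d.
  exists n, d, q => M x; split=> -[u].
    by case=> ? _ ?; exists u.
  by case=> ? ?; exists u; split=> // -[].
(* The linear forms rewritten along with the change of variables are the remaining equations, at
   [Some j], and the output, at [None]. *)
have [n1 [d1 [p1 H1]]] := impose_equation d (fun i => a i ord0)
  (fun i k => if k is Some j then a i (lift ord0 j) else q i).
have [n' [d' [p' H']]] :=
  IHm _ (fun i j => p1 i (Some j)) (fun i => p1 i None) d1.
exists n', d', p' => M x; rewrite -H'.
split=> [[u [ud ua uq]]|[u [ud ua uq]]].
  have /H1[v [vd vw]] : exists u' : 'I_n -> M,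
      [/\ forall i, act (u' i) (d i) = 0, \sum_i act (u' i) (a i ord0) = 0 &
          forall k, (if k is Some j then 0 else x) = \sum_i act (u' i)
            (if k is Some j then a i (lift ord0 j) else q i)].
    by exists u; split=> // -[j|]; rewrite ?ua.
  by exists v; split=> // [j|]; [rewrite -(vw (Some j))|rewrite -(vw None)].
have /H1[v [vd va vw]] : exists v : 'I_n1 -> M,
    (forall i, act (v i) (d1 i) = 0) /\
    forall k, (if k is Some j then 0 else x) = \sum_i act (v i) (p1 i k).
  by exists u; split=> // -[j|] //; rewrite ua.
exists v; split=> // [j|]; last exact: (vw None).
by case: (unliftP ord0 j) => [k ->|->]; [rewrite -(vw (Some k))|].
Qed.

Lemma linear_system_sum n m (a : 'I_n -> 'I_m -> R) (q : 'I_n -> R) :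
  exists n' (b c : 'I_n' -> R), forall (M : rmodType R) (x : M),
    (exists u : 'I_n -> M, (forall j, \sum_i act (u i) (a i j) = 0) /\
       x = \sum_i act (u i) (q i)) <->
    (exists t : 'I_n' -> M, (forall i, (act_im M (b i) `&` act_ker M (c i)) (t i)) /\
       x = \sum_i t i).
Proof.
have [n' [d [p H]]] := linear_system_normal_form a q.
have /choice[bc bcP] (i : 'I_n') : exists bc : R * R,
    forall (M : rmodType R) (x : M),
      (exists2 u, act u (d i) = 0 & x = act u (p i)) <->
      (act_im M bc.1 `&` act_ker M bc.2) x.
  (* If [d i = p i * z], the elements [u * p i] with [u * d i = 0] are the multiples of [p i] killed
     by [z]; if [p i = d i * z], only 0 is left, given by the pair [(0, 0)]. *)
  case: (uniserial_rdvd uniR (p i) (d i)) => -[z e].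
    exists (p i, z) => M x; split=> [[u ud ->]|[/= [u ->] h]].
      by split; [exists u | rewrite /act_ker /= -actM -e].
    by exists u => //; rewrite e actM.
  exists (0, 0) => M x; split=> [[u ud ->]|[/= [u ->] h]].
    by split; [exists u; rewrite act0 e actM ud act0l | rewrite /act_ker /= act0].
  by exists 0; rewrite !(act0, act0l).
exists n', (fun i => (bc i).1), (fun i => (bc i).2) => M x.
rewrite H; split=> [[u [ud xu]]|[t [tP xt]]].
  exists (fun i => act (u i) (p i)); split=> // i.
  by apply/bcP; exists (u i).
have /choice[u uP] i : exists u, act u (d i) = 0 /\ t i = act u (p i).
  by have /bcP[u ? ?] := tP i; exists u.
exists u; split=> [i|]; first by have [] := uP i.
by rewrite xt; apply: eq_bigr => i _; have [] := uP i.
Qed.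

Lemma pp_sol_sum (phi : pp_formula R 1) :
  exists n (b c : 'I_n -> R), forall (M : rmodType R) (x : 'rV[M]_1),
    pp_sol phi M x <->
    (exists t : 'I_n -> M, (forall i, (act_im M (b i) `&` act_ker M (c i)) (t i)) /\
       x 0 0 = \sum_i t i).
Proof.
(* The free variable is the unknown with index [l], and it is selected as the output. *)
pose l : 'I_(pp_bound phi + 1) := rshift _ ord0.
have [n [b [c H]]] := linear_system_sum (pp_mx phi) (fun i => (i == l)%:R).
exists n, b, c => M x; rewrite -H.
split=> [[y yP]|[u [ua]]].
  by exists (fun i => row_mx y x 0 i); rewrite act_sum_delta row_mxEr.
rewrite act_sum_delta => xu; exists (\row_k u (lshift 1 k)) => j.
rewrite -[RHS](ua j); apply: eq_bigr => i _; rewrite /act; congr (_ *: _).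
case: (split_ordP i) => k ->; first by rewrite row_mxEl mxE.
by rewrite row_mxEr (ord1 k) xu.
Qed.

End NormalForm.

(** * Limits along filters in pure-injective modules *)

Section QuotientModule.
Variables (R : pzRingType) (M : rmodType R) (U : set M).
Hypothesis subU : submodule U.

Definition congr_mod (x y : M) := `[< U (x - y) >].

Lemma congr_mod_refl : reflexive congr_mod.
Proof. by move=> x; apply/asboolP; rewrite subrr; case: subU. Qed.

Lemma congr_mod_sym : symmetric congr_mod.
Proof.
have [_ _ UZ] := subU.
suff sub x y : congr_mod x y -> congr_mod y x.
  by move=> x y; apply/idP/idP; exact: sub.
move=> /asboolP h; apply/asboolP.
by rewrite -opprB -scaleN1r; exact: UZ.
Qed.

Lemma congr_mod_trans : transitive congr_mod.
Proof.
have [_ UD _] := subU.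
move=> y x z /asboolP xy /asboolP yz; apply/asboolP.
by rewrite -(subrK y x) -addrA; exact: UD.
Qed.

Canonical congr_mod_equiv :=
  EquivRel congr_mod congr_mod_refl congr_mod_sym congr_mod_trans.

Definition quot_module := {eq_quot congr_mod_equiv}%qT.
HB.instance Definition _ := Choice.on quot_module.

Definition qproj (x : M) : quot_module := (\pi_quot_module x)%qT.
Definition qrepr (a : quot_module) : M := repr a.

Lemma qreprK a : qproj (qrepr a) = a.
Proof. exact: reprK. Qed.

Lemma qprojP x y : qproj x = qproj y <-> U (x - y).
Proof.
split=> [/eqP|h].
  by rewrite /qproj piE => /asboolP.
by apply/eqP; rewrite /qproj piE; apply/asboolP.
Qed.

Lemma qrepr_proj x : U (qrepr (qproj x) - x).
Proof. by apply/qprojP; rewrite qreprK. Qed.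

Definition qadd (a b : quot_module) := qproj (qrepr a + qrepr b).
Definition qopp (a : quot_module) := qproj (- qrepr a).
Definition qscale (r : R^c) (a : quot_module) := qproj (r *: qrepr a).

Lemma qaddE x y : qadd (qproj x) (qproj y) = qproj (x + y).
Proof.
have [_ UD _] := subU.
by apply/qprojP; rewrite opprD addrACA; apply: UD; exact: qrepr_proj.
Qed.

Lemma qscaleE r x : qscale r (qproj x) = qproj (r *: x).
Proof.
have [_ _ UZ] := subU.
by apply/qprojP; rewrite -scalerBr; apply: UZ; exact: qrepr_proj.
Qed.

Lemma qoppE x : qopp (qproj x) = qproj (- x).
Proof. by rewrite -scaleN1r -qscaleE /qscale scaleN1r. Qed.

Lemma qaddA : associative qadd.
Proof.
move=> a b c; rewrite -(qreprK a) -(qreprK b) -(qreprK c).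
by rewrite !qaddE addrA.
Qed.

Lemma qaddC : commutative qadd.
Proof. by move=> a b; rewrite -(qreprK a) -(qreprK b) !qaddE addrC. Qed.

Lemma qadd0 : left_id (qproj 0) qadd.
Proof. by move=> a; rewrite -(qreprK a) qaddE add0r. Qed.

Lemma qaddN : left_inverse (qproj 0) qopp qadd.
Proof. by move=> a; rewrite -(qreprK a) qoppE qaddE addNr. Qed.

HB.instance Definition _ :=
  GRing.isZmodule.Build quot_module qaddA qaddC qadd0 qaddN.

Lemma qscaleA r s a : qscale r (qscale s a) = qscale (r * s) a.
Proof. by rewrite -(qreprK a) !qscaleE scalerA. Qed.

Lemma qscale1 : left_id 1 qscale.
Proof. by move=> a; rewrite -(qreprK a) qscaleE scale1r. Qed.

Lemma qscaleDr : right_distributive qscale +%R.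
Proof.
move=> r a b; rewrite -(qreprK a) -(qreprK b).
by rewrite [_ + _]qaddE !qscaleE scalerDr -qaddE.
Qed.

Lemma qscaleDl a : {morph qscale^~ a : r s / r + s}.
Proof. by move=> r s; rewrite -(qreprK a) !qscaleE scalerDl -qaddE. Qed.

HB.instance Definition _ := GRing.Zmodule_isLmodule.Build R^c quot_module
  qscaleA qscale1 qscaleDr qscaleDl.

Lemma qproj_linear : linear (qproj : M -> quot_module).
Proof. by move=> r x y; rewrite -qaddE -qscaleE. Qed.

End QuotientModule.

(** Hides the construction by representatives: only a surjection with kernel [U] is used later. *)
Lemma quotient_module (R : pzRingType) (M : rmodType R) (U : set M) :
  submodule U ->
  exists (Q : rmodType R) (f : {linear M -> Q}),
    (forall a, exists x, f x = a) /\ forall x, f x = 0 <-> U x.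
Proof.
move=> subU.
pose lin := GRing.isLinear.Build _ _ _ _ _ (qproj_linear subU).
pose f : {linear M -> quot_module subU} := HB.pack (qproj subU) lin.
exists (quot_module subU : rmodType R), f; split=> [a|x].
  by exists (qrepr a); exact: qreprK.
by rewrite -(linear0 f) [f x = _]qprojP subr0.
Qed.

Definition proper_filter (I : Type) (F : set (set I)) :=
  [/\ F setT, forall A B, F A -> F B -> F (A `&` B),
      forall A B, A `<=` B -> F A -> F B & ~ F set0].

Lemma filter_forall (I : Type) (F : set (set I)) n (A : 'I_n -> set I) :
  proper_filter F -> (forall j, F (A j)) -> F [set i | forall j, A j i].
Proof.
move=> [FT FI FS _]; elim: n A => [|n IHn] A FA.
  by apply: FS FT => i _ [].
have /FI/(_ (FA ord0)) := IHn (A \o lift ord0) (fun j => FA _).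
apply: FS => i [/= Al A0] j.
by case: (unliftP ord0 j) => [k ->|->].
Qed.

Section Limits.
Variables (R : pzRingType) (M : rmodType R).

(** A linear retraction of the diagonal that factors through the reduced power modulo [F]. It is a
    choice of limits for all families at once; no topology on [M] is involved. *)
Definition is_limit (I : Type) (F : set (set I)) (lam : (I -> M) -> M) :=
  [/\ forall (r : R^c) x y, lam (fun i => r *: x i + y i) = r *: lam x + lam y,
      forall u, lam (fun=> u) = u &
      forall x y, F [set i | x i = y i] -> lam x = lam y].

(* The diagonal embedding of M into its reduced power modulo F is pure, and a
   splitting of it is a limit along F. *)
Lemma pure_injective_limit (I : Type) (F : set (set I)) :
  pure_injective M -> proper_filter F -> exists lam, is_limit F lam.
Proof.
move=> injM FF; have [FT FI FS F0] := FF.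
pose U : set (I -> M : rmodType R) := [set x | F [set i | x i = 0]].
have subU : submodule U.
  split=> [|x y Ux Uy|r x Ux].
  - by apply: FS FT => i _.
  - apply: FS (FI _ _ Ux Uy) => i [/= xi yi].
    by rewrite [LHS]/(x i + y i) xi yi; exact: addr0.
  - by apply: FS Ux => i /= xi; rewrite [LHS]/(r *: x i) xi; exact: scaler0.
have [Q [f [fsurj fU]]] := quotient_module subU.
have feq (x y : I -> M) : f x = f y <-> F [set i | x i = y i].
  have -> : (f x = f y) <-> f (x - y) = 0.
    rewrite linearB; split=> [e|]; last exact: subr0_eq.
    by apply/eqP; rewrite subr_eq0; apply/eqP.
  rewrite fU; split; apply: FS => i /= h; first exact: subr0_eq.
  by rewrite [LHS]/(x i - y i) h; exact: subrr.
pose d (u : M) : I -> M := fun=> u.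
have dlin : linear (f \o d) by move=> r u v; rewrite -linearP.
pose lin := GRing.isLinear.Build _ _ _ _ _ dlin.
pose g : {linear M -> Q} := HB.pack (f \o d) lin.
have gE u : g u = f (d u) by [].
have pure : pure_embedding g.
  split=> [u v /feq h|n phi x [y yP]].
    apply: contrapT => uv; apply: F0; apply: FS h => i /= e.
    by case: uv.
  have /choice[z zP] k : exists z : I -> M, f z = y 0 k by exact: fsurj.
  pose w i : 'rV[M]_(_ + n) := row_mx (\row_k z k i) x.
  have wP j : F [set i | \sum_k (pp_mx phi k j : R^c) *: w i 0 k = 0].
    pose s : I -> M := \sum_k (pp_mx phi k j : R^c) *: (fun i => w i 0 k).
    have : f s = 0.
      rewrite linear_sum -[RHS](yP j); apply: eq_bigr => k _.
      rewrite linearZ /=; congr (_ *: _).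
      case: (split_ordP k) => k' ->.
        rewrite row_mxEl -zP; congr (f _); apply/funext => i.
        by rewrite row_mxEl mxE.
      rewrite row_mxEr mxE gE; congr (f _); apply/funext => i.
      by rewrite row_mxEr.
    by move=> /fU; apply: FS => i /= si; rewrite -[RHS]si /s fct_sumE.
  (* Each of the finitely many equations holds on a member of [F], hence all hold together at some
     index [i], where the lifted witnesses give a solution in [M]. *)
  have allF := filter_forall FF wP.
  have [i wi] : exists i, forall j, \sum_k (pp_mx phi k j : R^c) *: w i 0 k = 0.
    apply: contrapT => no; apply: F0; apply: FS allF => i wi.
    by case: no; exists i.
  by exists (\row_k z k i).
have [h hK] := injM _ _ pure.
exists (h \o f); split=> [r x y|u|x y /feq e] /=.
- by rewrite -!linearP.
- exact: hK.
- by rewrite e.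
Qed.

End Limits.

(** * Idempotent endomorphisms *)

Section IdempotentMaps.
Variables (R : pzRingType) (M : rmodType R).
Implicit Types X Y : set (M -> M).

(** Plays the role of a closed set of maps, limits being taken pointwise; the existence of limits in
    a pure-injective module replaces compactness. *)
Definition limit_closed X :=
  forall (I : Type) (F : set (set I)) (lam : (I -> M) -> M),
    proper_filter F -> is_limit F lam ->
  forall f : I -> M -> M, (forall i, X (f i)) -> X (fun u => lam (f^~ u)).

Definition closed_semigroup X :=
  [/\ X !=set0, limit_closed X & forall f g, X f -> X g -> X (f \o g)].

Hypothesis injM : pure_injective M.

(** Zorn's lemma for reverse inclusion. The intersection of a chain is not empty: it contains a
    limit of elements chosen in the members, along the filter of tails of the chain. *)
Lemma minimal_closed_semigroup X : closed_semigroup X ->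
  exists Y, [/\ closed_semigroup Y, Y `<=` X &
    forall Z, closed_semigroup Z -> Z `<=` Y -> Z = Y].
Proof.
move=> cX.
pose T := {Y : set (M -> M) | closed_semigroup Y /\ Y `<=` X}.
pose le (Y Z : T) := `[< sval Z `<=` sval Y >].
have chains (A : set T) : total_on A le -> exists t, forall s, A s -> le s t.
  move=> totA; have [[Y0 AY0]|noA] := pselect (exists Y : T, A Y); last first.
    exists (exist _ X (conj cX (@subset_refl _ X))) => s As.
    by case: noA; exists s.
  pose W : set (M -> M) := fun f => forall Y : T, A Y -> sval Y f.
  suff cW : closed_semigroup W /\ W `<=` X.
    exists (exist _ W cW) => s As; apply/asboolP => f /= Wf; exact: Wf.
  split; last by move=> f /(_ _ AY0); case: (svalP Y0) => _; apply.
  split.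
  - have /choice[f fP] (Y : T) : exists f, sval Y f by case: (svalP Y) => -[].
    pose F : set (set T) := [set S | exists2 Z : T, A Z &
      forall Y : T, A Y -> sval Y `<=` sval Z -> S Y].
    have FF : proper_filter F.
      split.
      + by exists Y0.
      + move=> S S' [Z AZ SZ] [Z' AZ' SZ'].
        case: (totA _ _ AZ AZ') => /asboolP h; [exists Z'|exists Z] => // Y AY YZ.
          by split; [apply: SZ => // ? /YZ /h|exact: SZ'].
        by split; [exact: SZ|apply: SZ' => // ? /YZ /h].
      + by move=> S S' SS' [Z AZ SZ]; exists Z => // Y AY YZ; exact/SS'/SZ.
      + by case=> Z AZ /(_ Z AZ (@subset_refl _ _)).
    have [lam lamP] := pure_injective_limit injM FF.
    have [_ _ lamF] := lamP.
    exists (fun u => lam (f^~ u)) => Z AZ.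
    (* [f'] agrees with [f] on the tail below [Z], so it has the same limit, and all its values lie
       in [Z], so that [Z] being closed applies. *)
    pose f' (Y : T) := if `[< sval Y `<=` sval Z >] then f Y else f Z.
    have -> : (fun u => lam (f^~ u)) = (fun u => lam (f'^~ u)).
      apply/funext => u; apply: lamF; exists Z => // Y AY YZ /=.
      by rewrite /f'; case: asboolP.
    have [[_ cZ _] _] := svalP Z; apply: cZ FF lamP _ _ => Y.
    by rewrite /f'; case: asboolP => [YZ|_]; [exact/YZ/fP|exact: fP].
  - move=> I F lam FF lamP f fW Y AY; have [[_ cY _] _] := svalP Y.
    by apply: cY FF lamP _ _ => i; exact: fW.
  - move=> f g Wf Wg Y AY; have [[_ _ mY] _] := svalP Y.
    by apply: mY; [exact: Wf|exact: Wg].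
have [|||[Y [cY YX]] Ymin] := @Zorn T le _ _ _ chains.
- by move=> Y; apply/asboolP; exact: subset_refl.
- by move=> ? ? ? /asboolP h /asboolP h'; apply/asboolP; exact: subset_trans h' h.
- move=> [Z h] [Z' h'] /asboolP /= h1 /asboolP /= h2.
  by apply/eq_exist/seteqP.
exists Y; split=> // Z cZ ZY.
have ZX : Z `<=` X := subset_trans ZY YX.
by have [] := Ymin (exist _ Z (conj cZ ZX)) (introT (asboolP _) ZY).
Qed.

(* The Ellis-Numakura lemma. *)
Lemma closed_semigroup_idempotent X : closed_semigroup X ->
  exists2 e, X e & e \o e = e.
Proof.
move=> /minimal_closed_semigroup[Y [[[f Yf] cY mY] YX Ymin]].
(* Composition with [f] on the right commutes with pointwise limits, so [Y f] is again a closed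
   semigroup, and minimality gives [Y f = Y]. *)
have Yf_eq : [set g \o f | g in Y] = Y.
  apply: Ymin => [|_ [g Yg <-]]; last exact: mY.
  split.
  - by exists (f \o f); exists f.
  - move=> I F lam FF lamP h hP.
    have /choice[g gP] i : exists g, Y g /\ g \o f = h i.
      by have [g ? ?] := hP i; exists g.
    exists (fun u => lam (g^~ u)).
      by apply: cY FF lamP _ _ => i; have [] := gP i.
    apply/funext => u /=; congr lam; apply/funext => i.
    by have [_ <-] := gP i.
  - move=> _ _ [g Yg <-] [h Yh <-]; exists (g \o f \o h) => //.
    exact: (mY _ _ (mY _ _ Yg Yf) Yh).
have [g Yg gf] : [set g \o f | g in Y] f by rewrite Yf_eq.
(* Not empty by the previous equality, and closed because limits of constant families are constant;
   by minimality it contains [f] itself. *)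
have : [set g | Y g /\ g \o f = f] = Y.
  apply: Ymin => [|h []] //; split.
  - by exists g.
  - move=> I F lam FF lamP h hP; split.
      by apply: cY FF lamP _ _ => i; have [] := hP i.
    apply/funext => u /=; have [_ lamC _] := lamP.
    rewrite -[RHS]lamC; congr lam; apply/funext => i.
    by have [_ /(congr1 (@^~ u))] := hP i.
  - move=> h h' [Yh hf] [Yh' h'f]; split; first exact: mY.
    by rewrite -compA h'f.
move=> eqY; exists f; first exact: YX.
by move: (Yf); rewrite -{1}eqY => -[].
Qed.

(** A predicate on bare functions, so that it can be one of the conditions defining a closed
    semigroup. *)
Definition linear_map (f : M -> M) :=
  forall (r : R^c) u v, f (r *: u + v) = r *: f u + f v.

Lemma limit_closed_linear_map : limit_closed linear_map.
Proof.
move=> I F lam FF [lamL _ _] f fL r u v.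
by rewrite -lamL; congr lam; apply/funext => i; rewrite fL.
Qed.

Lemma linear_map_comp f g : linear_map f -> linear_map g -> linear_map (f \o g).
Proof. by move=> fL gL r u v; rewrite /= gL fL. Qed.

(** [M] is the direct sum of the range and the kernel of [e]. *)
Lemma indecomposable_idempotent (e : M -> M) :
  indecomposable M -> linear_map e -> e \o e = e ->
  (forall u, e u = 0) \/ (forall u, e u = u).
Proof.
move=> [_ indM] eL ee.
have eK u : e (e u) = e u by exact: (congr1 (@^~ u) ee).
have e0 : e 0 = 0.
  by have := eL (- 1) 0 0; rewrite scaler0 addr0 scaleN1r addNr.
have eD u v : e (u + v) = e u + e v by have := eL 1 u v; rewrite !scale1r.
have eZ r u : e (r *: u) = r *: e u by have := eL r u 0; rewrite !addr0 e0 addr0.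
have eB u : e (u - e u) = 0.
  by rewrite eD -scaleN1r eZ scaleN1r eK subrr.
have subU : submodule (range e).
  split; first by exists 0.
    by move=> _ _ [u _ <-] [v _ <-]; exists (u + v).
  by move=> r _ [u _ <-]; exists (r *: u).
have subV : submodule [set u | e u = 0].
  split=> //=; first by move=> u v; rewrite eD => -> ->; rewrite addr0.
  by move=> r u; rewrite eZ => ->; rewrite scaler0.
have [||h|h] := indM _ _ subU subV.
- apply/seteqP; split=> [_ [[u _ <-]] /=|_ ->]; first by rewrite eK.
  by split; [exists 0|].
- by move=> w; exists (e w), (w - e w); split=> //; rewrite addrC subrK.
- left=> u; have : range e (e u) by exists u.
  by rewrite h.
- right=> u; have : [set u | e u = 0] (u - e u) by exact: eB.
  by rewrite h => /subr0_eq.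
Qed.

End IdempotentMaps.

(** * Indecomposable pure-injectives over uniserial rings *)

Section EndomorphismChain.
Variables (R : pzRingType) (M : rmodType R).

(* A pp-type is realised by the image of an endomorphism as soon as every
   system of equations it contains is: the maps respecting finitely many
   instances of linearity have a limit. *)
Lemma pure_injective_endomorphism (c : M) (X : set M) : pure_injective M ->
  (forall (I : Type) (F : set (set I)) lam, is_limit F lam ->
    forall x : I -> M, (forall i, X (x i)) -> X (lam x)) ->
  (forall n m (a : 'I_n -> 'I_m -> R) (q : 'I_n -> R),
    (exists u : 'I_n -> M, (forall j, \sum_i act (u i) (a i j) = 0) /\
       c = \sum_i act (u i) (q i)) ->
    (exists u : 'I_n -> M, (forall j, \sum_i act (u i) (a i j) = 0) /\
       X (\sum_i act (u i) (q i)))) ->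
  exists2 f, linear_map f & X (f c).
Proof.
move=> injM limX solX.
have /choice[f fP] (l : seq (R^c * M * M)) : exists f : M -> M, X (f c) /\
    forall r u v, (r, u, v) \in l -> f (r *: u + v) = r *: f u + f v.
  (* One unknown for [c] and for each element occurring in [l]; [k] gives the index of the unknown
     standing for an element. Outside the list [k] takes a default value, which no equation sees. *)
  pose L' := flatten [seq [:: x.1.2; x.2; x.1.1 *: x.1.2 + x.2] | x <- l].
  pose k u : 'I_(size L').+1 := inord (index u (c :: L')).
  have nthk u : u \in c :: L' -> nth 0 (c :: L') (k u) = u.
    move=> uL; rewrite inordK ?nth_index //.
    by move: uL; rewrite -index_mem ltnS.
  pose x (j : 'I_(size l)) := nth (0, 0, 0) l j.
  (* Column [j] expresses linearity at the [j]-th triple of [l]. The elements of the list themselves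
     solve this system with output [c]. *)
  pose a i j : R := (i == k ((x j).1.1 *: (x j).1.2 + (x j).2))%:R
    - ((i == k (x j).1.2)%:R * ((x j).1.1 : R) + (i == k (x j).2)%:R).
  have aE (u : 'I_(size L').+1 -> M) j : \sum_i act (u i) (a i j) =
      u (k ((x j).1.1 *: (x j).1.2 + (x j).2))
      - ((x j).1.1 *: u (k (x j).1.2) + u (k (x j).2)).
    under eq_bigr do rewrite actBr actDr actM.
    by rewrite sumrB big_split /= -act_suml !act_sum_delta.
  have [|u [ua Xu]] := solX _ _ a (fun i => (i == k c)%:R).
    exists (fun i => nth 0 (c :: L') i); split=> [j|].
      have xL y :
          y \in [:: (x j).1.2; (x j).2; (x j).1.1 *: (x j).1.2 + (x j).2] ->
          y \in c :: L'.
        move=> yx; rewrite inE; apply/orP; right; apply/flattenP.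
        exists [:: (x j).1.2; (x j).2; (x j).1.1 *: (x j).1.2 + (x j).2] => //.
        by apply/mapP; exists (x j) => //; exact: mem_nth.
      by rewrite aE !nthk ?subrr // xL // !inE eqxx ?orbT.
    by rewrite act_sum_delta nthk // inE eqxx.
  exists (u \o k); split; first by rewrite act_sum_delta in Xu.
  move=> r v w vw; have jl : (index (r, v, w) l < size l)%N by rewrite index_mem.
  have := ua (Ordinal jl); rewrite aE /x /= nth_index //=.
  exact: subr0_eq.
(* Each instance of linearity holds for all lists containing it, hence on a member of this
   filter. *)
pose F : set (set (seq (R^c * M * M))) :=
  [set S | exists l0 : seq (R^c * M * M),
    forall l : seq (R^c * M * M), {subset l0 <= l} -> S l].
have FF : proper_filter F.
  split.
  - by exists [::].
  - move=> A B [l lA] [l' lB]; exists (l ++ l') => m sm.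
    by split; [apply: lA|apply: lB] => y yl; apply: sm; rewrite mem_cat yl ?orbT.
  - by move=> A B AB [l lA]; exists l => m /lA /AB.
  - by move=> [l /(_ l)]; apply.
have [lam lamP] := pure_injective_limit injM FF; have [lamL _ lamF] := lamP.
exists (fun u => lam (f^~ u)) => [r u v|].
  rewrite -lamL; apply: lamF; exists [:: (r, u, v)] => l sl /=.
  by have [_ ->] := fP l; rewrite ?sl ?inE.
by apply: limX lamP _ _ => l; have [] := fP l.
Qed.

Hypothesis uniR : uniserial R.

(* The relevant instance of distributivity of the pp-lattice. *)
Lemma act_im_distributive (s h : R) n (b c : 'I_n -> R) (t : 'I_n -> M) (y z : M) :
  (forall i, (act_im M (b i) `&` act_ker M (c i)) (t i)) ->
  act_im M s y -> act_ker M h z -> y = \sum_i t i + z ->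
  exists w (t' : 'I_n -> M), [/\ act_im M s w, act_ker M h w,
    forall i, (act_im M (b i) `&` act_ker M (c i)) (t' i) & y = \sum_i t' i + w].
Proof.
have imB x x' : act_im M s x -> act_im M s x' -> act_im M s (x - x').
  by move=> [u ->] [v ->]; exists (u - v); rewrite actBl.
elim: n b c t y z => [|n IHn] b c t y z tP ys zh.
  rewrite big_ord0 add0r => yz; exists y, t; split=> //; first by rewrite yz.
  by rewrite big_ord0 add0r.
have drop i0 y1 z1 : act_im M s y1 -> act_ker M h z1 ->
    y1 = \sum_j t (lift i0 j) + z1 ->
    (exists2 x, (act_im M (b i0) `&` act_ker M (c i0)) x & y = x + y1) ->
  exists w (t' : 'I_n.+1 -> M), [/\ act_im M s w, act_ker M h w,
    forall i, (act_im M (b i) `&` act_ker M (c i)) (t' i) & y = \sum_i t' i + w].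
  move=> y1s z1h y1E [x xP yE].
  have [|w [t' [ws wh t'P y1t']]] :=
    IHn (b \o lift i0) (c \o lift i0) (t \o lift i0) y1 z1 _ y1s z1h y1E.
    by move=> j; exact: tP.
  have [t1 t10 t1l] := ord_extend i0 x t'.
  exists w, t1; split=> // [j|].
    by case: (unliftP i0 j) => [k ->|->]; rewrite ?t10 // t1l; exact: t'P.
  rewrite (bigD1_ord i0) //= t10 yE y1t' addrA.
  by congr (_ + _ + _); apply: eq_bigr => j _; rewrite t1l.
have zero i : (act_im M (b i) `&` act_ker M (c i)) 0.
  by split; [exists 0; rewrite act0l|rewrite /act_ker /= act0l].
have [[i0 ts]|nots] := pselect (exists i, act_im M s (t i)).
  move=> yE; apply: (drop i0 (y - t i0) z) => //; first exact: imB.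
    by rewrite yE (bigD1_ord i0) //= addrAC [t i0 + _]addrC addrK.
  by exists (t i0); rewrite // addrC subrK.
have [[i0 th]|noth] := pselect (exists i, act_ker M h (t i)).
  move=> yE; apply: (drop i0 y (t i0 + z)) => //.
  - by rewrite /act_ker /= actDl th zh addr0.
  - by rewrite yE (bigD1_ord i0) //= addrA; congr (_ + _); rewrite addrC.
  - by exists 0; rewrite ?add0r.
(* Now no [t i] lies in the image of [s] or the kernel of [h]. The chosen [c i0] kills every [t j];
   it is a right multiple of [h], since otherwise [h] would kill [t i0], so it kills [z] and [y].
   Likewise [s] is a left multiple of [b i0]. Thus [y] itself serves as the summand [i0], with
   [w = 0]. *)
move=> yE; have [i0 i0max] : exists i, forall j, exists z, c i = c j * z.
  have [||i] := ord_max_elt (le := fun x y => exists z, y = x * z) c.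
  - by move=> x x'; case: (uniserial_rdvd uniR x x'); tauto.
  - by move=> x x' x'' [u ->] [v ->]; exists (u * v); rewrite mulrA.
  - by move=> iP; exists i.
have yc : act y (c i0) = 0.
  rewrite yE actDl act_suml big1 => [|j _]; last first.
    have [e ->] := i0max j; rewrite actM; have [_ ->] := tP j.
    exact: act0l.
  have [[e ->]|[e he]] := uniserial_rdvd uniR h (c i0).
    by rewrite actM zh act0l addr0.
  case: noth; exists i0; rewrite /act_ker /= he actM.
  by have [_ ->] := tP i0; exact: act0l.
have yb : act_im M (b i0) y.
  have [[e be]|[e se]] := uniserial_ldvd uniR s (b i0).
    by case: nots; exists i0; have [[u ->] _] := tP i0; exists (act u e);
       rewrite be actM.
  by have [u ->] := ys; exists (act u e); rewrite se actM.
have [t1 t10 t1l] := ord_extend i0 y (fun=> 0 : M).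
exists 0, t1; split.
- by exists 0; rewrite act0l.
- by rewrite /act_ker /= act0l.
- by move=> j; case: (unliftP i0 j) => [k ->|->]; rewrite ?t10 // t1l.
- by rewrite addr0 (bigD1_ord i0) //= t10 big1 ?addr0 // => j _; rewrite t1l.
Qed.

Hypotheses (injM : pure_injective M) (indM : indecomposable M).

Lemma act_im_ker_chain (s h : R) :
  act_im M s `<=` act_ker M h \/ act_ker M h `<=` act_im M s.
Proof.
have imE (f : M -> M) u r : linear_map f -> f (act u r) = act (f u) r.
  move=> fL; have := fL (- 1) 0 0; rewrite scaler0 addr0 scaleN1r addNr => f0.
  by have := fL (r : R^c) u 0; rewrite f0 !addr0.
have [//|/existsNP[a /not_implyP[as_ ah]]] :=
  pselect (act_im M s `<=` act_ker M h); first by left.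
have [//|/existsNP[b /not_implyP[bh bs]]] :=
  pselect (act_ker M h `<=` act_im M s); first by right.
exfalso.
pose W : set M := act_im M s `&` act_ker M h.
have limW (x0 : M) (I : Type) (F : set (set I)) lam : is_limit F lam ->
    forall x : I -> M, (forall i, W (x i - x0)) -> W (lam x - x0).
  move=> [lamL lamC lamF] x xX.
  have /choice[v vP] i : exists v, x i = act v s + x0.
    by have [[v xv] _] := xX i; exists v; rewrite -xv subrK.
  have lamZ r y : lam (fun i => act (y i) r) = act (lam y) r.
    have := lamL (r : R^c) y (fun=> 0); rewrite lamC addr0 /act => <-.
    by congr lam; apply/funext => i; rewrite addr0.
  have -> : lam x = act (lam v) s + x0.
    rewrite -[act _ s]/((s : R^c) *: _) -[in RHS](lamC x0) -lamL.
    by congr lam; apply/funext => i; rewrite vP.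
  rewrite addrK; split; first by exists (lam v).
  rewrite /act_ker /= -!lamZ -[RHS]lamC; congr lam; apply/funext => i.
  by have [_] := xX i; rewrite vP addrK.
(* The aim is to send [a + b] into the coset [a + W]. Given a system with output [a + b],
   distributivity applied to [a = \sum_i t i - b] yields [w] in [W] such that [a - w] is also an
   output. *)
have [|f fL [fs fh]] := pure_injective_endomorphism (c := a + b)
  (X := [set x | W (x - a)]) injM (limW a).
  move=> n m A q sol; have [n' [d [e H]]] := linear_system_sum uniR A q.
  have /H[t [tP abE]] : exists u : 'I_n -> M,
      (forall j, \sum_i act (u i) (A i j) = 0) /\ a + b = \sum_i act (u i) (q i).
    by [].
  have aE : a = \sum_i t i - b by rewrite -abE addrK.
  have bh' : act_ker M h (- b) by rewrite /act_ker /= actNl bh oppr0.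
  have [w [t' [ws wh t'P aE']]] := act_im_distributive tP as_ bh' aE.
  have [u [uA uq]] : exists u : 'I_n -> M,
      (forall j, \sum_i act (u i) (A i j) = 0) /\ a - w = \sum_i act (u i) (q i).
    by apply/H; exists t'; split=> //; rewrite aE' addrK.
  exists u; split=> //; rewrite -uq /= addrAC subrr add0r.
  split; first by have [y ->] := ws; exists (- y); rewrite actNl.
  by rewrite /act_ker /= actNl wh oppr0.
have imB x y : act_im M s x -> act_im M s y -> act_im M s (x - y).
  by move=> [u ->] [v ->]; exists (u - v); rewrite actBl.
have kerB x y : act_ker M h x -> act_ker M h y -> act_ker M h (x - y).
  by rewrite /act_ker /= actBl => -> ->; rewrite subrr.
have WB x y : W x -> W y -> W (x - y).
  by move=> [xs xh] [ys yh]; split; [exact: imB|exact: kerB].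
have W0 : W 0 by split; [exists 0; rewrite act0l|rewrite /act_ker /= act0l].
have WD x y : W x -> W y -> W (x + y).
  by move=> Wx Wy; have := WB _ _ Wx (WB _ _ W0 Wy); rewrite sub0r opprK.
have mapD (g : M -> M) x y : linear_map g -> g (x + y) = g x + g y.
  by move=> gL; have := gL 1 x y; rewrite !scale1r.
have map_im (g : M -> M) x : linear_map g -> act_im M s x -> act_im M s (g x).
  by move=> gL [u ->]; exists (g u); rewrite imE.
have map_ker (g : M -> M) x : linear_map g -> act_ker M h x -> act_ker M h (g x).
  by move=> gL xh; rewrite /act_ker /= -imE // xh -(act0 (0 : M)) imE // !act0.
have mapW (g : M -> M) x : linear_map g -> W x -> W (g x).
  by move=> gL [xs xh]; split; [exact: map_im|exact: map_ker].
pose T : set (M -> M) := [set g | [/\ linear_map g, W (g a - a) & W (g b)]].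
have cT : closed_semigroup T.
  split.
  (* [f b] is killed by [h] because [b] is, and it is the difference of [f a + f b - a] and
     [f a - a], both multiples of [s]. So [f b] is in [W], and then so is [f a - a]. *)
  - exists f; have fab : W (f a + f b - a) by rewrite -mapD.
    have fb : W (f b).
      split; last exact: map_ker.
      have -> : f b = f a + f b - a - (f a - a).
        by rewrite opprB addrA subrK addrAC subrr add0r.
      by apply: (imB); [case: fab|apply: imB => //; exact: map_im].
    split=> //; have -> : f a - a = f a + f b - a - f b by rewrite addrAC addrK.
    exact: WB.
  - move=> I F lam FF lamP g gT; split.
    + by apply: limit_closed_linear_map FF lamP _ _ => i; case: (gT i).
    + by apply: limW lamP _ _ => i; case: (gT i).
    + by rewrite -[lam _]subr0; apply: limW lamP _ _ => i; rewrite subr0; case: (gT i).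
  - move=> g g' [gL ga gb] [g'L g'a g'b]; split.
    + exact: linear_map_comp.
    + have -> : (g \o g') a - a = g (g' a - a) + (g a - a).
        by rewrite addrA -mapD // subrK.
      by apply: WD => //; exact: mapW.
    + rewrite /=; exact: mapW.
have [e [eL ea eb] ee] := closed_semigroup_idempotent injM cT.
have [e0|e1] := indecomposable_idempotent indM eL ee.
  apply: ah; have [_] := ea; rewrite e0 sub0r /act_ker /= actNl.
  by move=> /eqP; rewrite oppr_eq0 => /eqP.
by apply: bs; have [] := eb; rewrite e1.
Qed.

End EndomorphismChain.

(** * Two-sided ideals attached to a module *)

Section ModuleIdeals.
Variables (R : pzRingType) (M : rmodType R).

Definition annihilator : set R := [set r | forall u : M, act u r = 0].

Definition noninjective : set R := [set r | exists2 u : M, u <> 0 & act u r = 0].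

Definition nonsurjective : set R := [set r | exists u : M, ~ act_im M r u].

Definition left_invertible (a : R) := exists c, c * a = 1.

(** Exactness in the middle of multiplication by [s] followed by multiplication by [h]. *)
Definition exact_at (s h : R) := act_im M s = act_ker M h.

Lemma annihilator_ideal : two_sided_ideal annihilator.
Proof.
split; split.
- exact: act0.
- by move=> x y xM yM u; rewrite actDr xM yM addr0.
- by move=> x r xM u; rewrite actM xM act0l.
- exact: act0.
- by move=> x y xM yM u; rewrite actDr xM yM addr0.
- by move=> r x xM u; rewrite actM.
Qed.

(** If [c * a = 1] then [u = (u c) a], so multiplication by [a] is onto. *)
Lemma act_im_left_invertible a s : left_invertible a ->
  act_im M (a * s) = act_im M s.
Proof.
move=> [c ca]; apply/seteqP; split=> _ [u ->].
  by exists (act u a); rewrite actM.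
by exists (act u c); rewrite !actM -(actM u c a) ca act1.
Qed.

Lemma act_im_sub_ker s h : act_im M s `<=` act_ker M h <-> annihilator (s * h).
Proof.
split=> [sh u|sh _ [u ->]]; first by rewrite actM; apply: sh; exists u.
by rewrite /act_ker /= -actM sh.
Qed.

Lemma act_imM u s : act_im M (u * s) `<=` act_im M s.
Proof. by move=> _ [x ->]; exists (act x u); rewrite actM. Qed.

Lemma act_kerM h u : act_ker M h `<=` act_ker M (h * u).
Proof. by move=> x; rewrite /act_ker /= actM => ->; rewrite act0l. Qed.

Hypothesis chainM : forall s h,
  act_im M s `<=` act_ker M h \/ act_ker M h `<=` act_im M s.

(** The inclusion says that [M] is the sum of [M z] and the kernel of [b]; as these are comparable,
    one of them is all of [M]. *)
Lemma act_imM_eq z b : act_im M b `<=` act_im M (z * b) <->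
  annihilator b \/ ~ nonsurjective z.
Proof.
split=> [sub|[bM|zsurj] _ [u ->]].
- have [bM|bM] := pselect (annihilator b); [by left|right=> -[u nu]].
  have all v : exists w, act_ker M b (v - act w z).
    have [w vE] : act_im M (z * b) (act v b) by apply: sub; exists v.
    by exists w; rewrite /act_ker /= actBl vE actM subrr.
  have [zb|bz] := chainM z b.
    apply: bM => v; have [w] := all v.
    rewrite /act_ker /= actBl -actM => /subr0_eq ->.
    by rewrite actM; apply: zb; exists w.
  have [w /bz[w' uE]] := all u; apply: nu.
  by exists (w' + w); rewrite actDl -uE subrK.
- by exists 0; rewrite bM act0l.
- have [v ->] : act_im M z u by apply: contrapT => nu; apply: zsurj; exists u.
  by exists v; rewrite actM.
Qed.

(** Dually, the inclusion says that [M e] meets the kernel of [z] in 0; as these are comparable, one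
    of them is 0. *)
Lemma act_kerM_eq e z : act_ker M (e * z) `<=` act_ker M e <->
  annihilator e \/ ~ noninjective z.
Proof.
split=> [sub|[eM|zinj] x xe].
- have [eM|eM] := pselect (annihilator e); [by left|right=> -[u nu uz]].
  have [ez|ze] := chainM e z.
    apply: eM => v; apply: sub; rewrite /act_ker /= actM.
    by apply: ez; exists v.
  have [v uE] := ze _ uz; apply: nu; rewrite uE; apply: sub.
  by rewrite /act_ker /= actM -uE.
- exact: eM.
- apply: contrapT => xe0; apply: zinj; exists (act x e) => //.
  by rewrite -actM.
Qed.

(** By comparability the kernel of [b] lies in [M s] and that of [h] in [M b]. Hence [M s] is the
    preimage of [M s b] under [b], and the kernel of [h] is the image under [b] of that of
    [b * h]. *)
Lemma exact_at_shift s b h : ~ annihilator (s * b) -> ~ annihilator (b * h) ->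
  exact_at (s * b) h <-> exact_at s (b * h).
Proof.
move=> sb bh; have [|bs] := chainM s b; first by move/act_im_sub_ker.
have [/act_im_sub_ker //|hb] := chainM b h.
split=> e; apply/seteqP; split=> x.
- move=> [u ->]; rewrite /act_ker /= actM -(actM u).
  by have : act_im M (s * b) (act u (s * b)) by [exists u]; rewrite e.
- rewrite /act_ker /= actM => xh.
  have [u xE] : act_im M (s * b) (act x b) by rewrite e.
  have /bs[v xsE] : act_ker M b (x - act u s).
    by rewrite /act_ker /= actBl xE actM subrr.
  by exists (v + u); rewrite actDl -xsE subrK.
- move=> [u ->]; rewrite /act_ker /= -actM -mulrA actM.
  by have : act_im M s (act u s) by [exists u]; rewrite e.
- move=> /[dup] /hb [u ->]; rewrite /act_ker /= -actM => uh.
  have [v ->] : act_im M s u by rewrite e.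
  by exists v; rewrite actM.
Qed.

Hypotheses (uniR : uniserial R) (nzM : exists v : M, v != 0).

(** For sums, one term is a right multiple of the other. For [r * x], either [M r] lies in the
    kernel of [x] and [r * x] acts as 0, or an element killed by [x] has the form [w r]. *)
Lemma noninjective_ideal : two_sided_ideal noninjective.
Proof.
have [v /eqP v0] := nzM.
have add x y : noninjective x -> noninjective y -> noninjective (x + y).
  have [] := uniserial_rdvd uniR x y => -[z ->].
    by move=> [u u0 ux] _; exists u; rewrite // actDr actM ux act0l addr0.
  by move=> _ [u u0 uy]; exists u; rewrite // actDr actM uy act0l addr0.
have zero : noninjective 0 by exists v; rewrite // act0.
split; split=> //.
  by move=> x r [u u0 ux]; exists u; rewrite // actM ux act0l.
move=> r x [u u0 ux]; have [rx|xr] := chainM r x.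
  by exists v => //; rewrite actM; apply: rx; exists v.
have [w uE] := xr _ ux; exists w; last by rewrite actM -uE.
by move=> w0; apply: u0; rewrite uE w0 act0l.
Qed.

(** For [x * r], either [M x] lies in the kernel of [r] and [x * r] acts as 0, or that kernel lies
    in [M x] and [u] outside [M x] gives [u r] outside [M x r]. *)
Lemma nonsurjective_ideal : two_sided_ideal nonsurjective.
Proof.
have [v /eqP v0] := nzM.
have left r x : nonsurjective x -> nonsurjective (r * x).
  by move=> [u nu]; exists u => /act_imM.
have add x y : nonsurjective x -> nonsurjective y -> nonsurjective (x + y).
  have [] := uniserial_ldvd uniR x y => -[z ->] nx ny.
    by rewrite -[X in X + _]mul1r -mulrDl; exact: left.
  by rewrite -[X in _ + X]mul1r -mulrDl; exact: left.
have zero : nonsurjective 0 by exists v => -[w]; rewrite act0.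
split; split=> // x r [u nu].
have [xr|rx] := chainM x r.
  by exists v => -[w vE]; apply: v0; rewrite vE actM; apply: xr; exists w.
have [w wE] : exists w, ~ act_im M (x * r) w; last by exists w.
exists (act u r) => -[w uE]; apply: nu.
have /rx[w' uw] : act_ker M r (u - act w x).
  by rewrite /act_ker /= actBl uE actM subrr.
by exists (w' + w); rewrite actDl -uw subrK.
Qed.

End ModuleIdeals.

Section PrincipalIdeal.
Variable R : pzRingType.
Hypothesis uniR : uniserial R.

(* As r or 1 + r is left invertible for every r, these elements form the
   two-sided ideal generated by s. *)
Definition principal_ideal (s : R) : set R :=
  [set x | exists a b, left_invertible a /\ x = a * s * b].

Lemma principal_ideal_self s : principal_ideal s s.
Proof. by exists 1, 1; split; [exists 1; rewrite mul1r|rewrite mul1r mulr1]. Qed.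

(** One of [r] and [1 + r] is a left multiple of the other, hence so is their difference 1. *)
Lemma left_invertible_or (r : R) : left_invertible r \/ left_invertible (1 + r).
Proof.
have [] := uniserial_ldvd uniR r (1 + r) => -[z e].
  by left; exists (z - 1); rewrite mulrBl -e mul1r addrK.
by right; exists (1 - z); rewrite mulrBl -e mul1r addrK.
Qed.

Lemma principal_ideal_two_sided s : two_sided_ideal (principal_ideal s).
Proof.
have add x y : principal_ideal s x -> principal_ideal s y ->
    principal_ideal s (x + y).
  move=> [a [b [ai ->]]] [a' [b' [a'i ->]]].
  (* Whichever of [a * s] and [a' * s] divides the other is a common left factor of both
     summands. *)
  have [] := uniserial_rdvd uniR (a * s) (a' * s) => -[z e].
    by exists a, (b + z * b'); split=> //; rewrite mulrDr mulrA -e.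
  by exists a', (z * b + b'); split=> //; rewrite mulrDr mulrA -e.
have zero : principal_ideal s 0.
  by exists 1, 0; split; [exists 1; rewrite mul1r|rewrite mulr0].
have unit_l a x : left_invertible a -> principal_ideal s x ->
    principal_ideal s (a * x).
  move=> [c ca] [a' [b [[c' ca'] ->]]]; exists (a * a'), b.
  split; last by rewrite !mulrA.
  by exists (c' * c); rewrite mulrA -(mulrA c') ca mulr1.
split; split=> //.
  by move=> _ r [a [b [ai ->]]]; exists a, (b * r); rewrite !mulrA.
move=> r x sx; have [ri|ri] := left_invertible_or r; first exact: unit_l.
have -> : r * x = (1 + r) * x + (- 1) * x.
  by rewrite -mulrDl addrAC subrr add0r.
apply: add; apply: unit_l => //.
by exists (- 1); rewrite mulrNN mulr1.
Qed.

End PrincipalIdeal.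

(** * Topological types *)

Section Invariants.
Variable R : pzRingType.
Hypothesis uniR : uniserial R.

(** Pairs in which [s] or [h] annihilates [M] are excluded: there exactness amounts to injectivity
    of [h] or surjectivity of [s], which the other invariants decide. *)
Definition exact_ideals (M : rmodType R) : set (set R) :=
  [set J | exists s h, [/\ exact_at M s h, ~ annihilator M s,
     ~ annihilator M h & J = principal_ideal s]].

Definition same_ideals (M N : rmodType R) :=
  [/\ annihilator M = annihilator N, noninjective M = noninjective N,
      nonsurjective M = nonsurjective N & exact_ideals M = exact_ideals N].

Definition chain_module (M : rmodType R) := forall s h,
  act_im M s `<=` act_ker M h \/ act_ker M h `<=` act_im M s.

(** Apart from the annihilating cases, some pair [(s1, h1)] is exact in [M] with [s = a * s1 * b].
    In [N], exactness moves from [(s1 * b, h)] to [(s1, b * h)]; it is transferred to [M] by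
    comparing [b * h] with [h1], and moved back. *)
Lemma same_ideals_exact_at (M N : rmodType R) s h :
  chain_module M -> chain_module N -> same_ideals M N ->
  exact_at N s h -> exact_at M s h.
Proof.
move=> chM chN [eA eP eQ eD] eN.
have [sA|sA] := pselect (annihilator N s).
  have inj : ~ noninjective M h.
    rewrite eP => -[u u0 uh]; apply: u0.
    have [w ->] : act_im N s u by rewrite eN.
    exact: sA.
  rewrite -eA in sA; apply/seteqP; split=> x.
    by move=> [u ->]; rewrite sA /act_ker /= act0l.
  move=> xh; exists 0; rewrite act0l; apply: contrapT => x0; apply: inj.
  by exists x.
have [hA|hA] := pselect (annihilator N h).
  have surj : ~ nonsurjective M s.
    by rewrite eQ => -[u]; apply; rewrite eN; exact: hA.
  apply/seteqP; split=> x _; first by rewrite -eA in hA; exact: hA.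
  by apply: contrapT => xs; apply: surj; exists x.
have : exact_ideals M (principal_ideal s) by rewrite eD; exists s, h.
move=> [s1 [h1 [eM s1A h1A gens]]].
have [a [b [ai sE]]] : principal_ideal s1 s.
  by rewrite -gens; exact: principal_ideal_self.
have imN : act_im N s = act_im N (s1 * b).
  by rewrite sE -mulrA act_im_left_invertible.
have imM : act_im M s = act_im M (s1 * b).
  by rewrite sE -mulrA act_im_left_invertible.
have s1b : ~ annihilator N (s1 * b).
  by move=> s1b; apply: sA => u; rewrite sE -mulrA actM s1b.
have bs1 : act_ker N b `<=` act_im N s1.
  by have [/act_im_sub_ker|] := chN s1 b.
(* [s1] is not onto in [M], since [h1] does not annihilate [M]; so it is not onto in [N]. If [b * h]
   annihilated [N], then [N b] would lie in [N s1 b], and [s1] would be onto as the kernel of [b]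
   lies in [N s1]. *)
have bh : ~ annihilator N (b * h).
  move=> bh; have : nonsurjective N s1.
    rewrite -eQ; apply: contrapT => surj; apply: h1A => u.
    have : act_im M s1 u by apply: contrapT => ns; apply: surj; exists u.
    by rewrite eM.
  move=> [u []]; have : act_ker N h (act u b) by rewrite /act_ker /= -actM bh.
  rewrite -eN imN => -[w wE].
  have /bs1[w' uw] : act_ker N b (u - act w s1).
    by rewrite /act_ker /= actBl wE actM subrr.
  by exists (w' + w); rewrite actDl -uw subrK.
have eN1 : exact_at N s1 (b * h).
  by apply/exact_at_shift => //; rewrite /exact_at -imN.
have sub (M' : rmodType R) s' h' :
    exact_at M' s' h' -> annihilator M' (s' * h').
  by move=> e; apply/act_im_sub_ker; rewrite e.
have eM1 : exact_at M s1 (b * h).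
  have eM1' := sub _ _ _ eM; have eN1' := sub _ _ _ eN1.
  apply/seteqP; split; first by apply/act_im_sub_ker; rewrite eA.
  (* If [b * h = h1 * w], the required inclusion of kernels depends only on [h1] annihilating or [w]
     acting injectively, and it holds in [N] because [s1 * h1] annihilates [N]. *)
  rewrite eM; have [[w ->]|[w hE]] := uniserial_rdvd uniR (b * h) h1.
    exact: act_kerM.
  rewrite hE; apply/(act_kerM_eq chM).
  have : annihilator N h1 \/ ~ noninjective N w.
    apply/(act_kerM_eq chN); rewrite -hE -[act_ker N _]eN1.
    by apply/act_im_sub_ker; rewrite -eA.
  by rewrite eA eP.
by rewrite /exact_at imM; apply/exact_at_shift => //; rewrite eA.
Qed.

Definition basic_pp (M : rmodType R) (b c : R) := act_im M b `&` act_ker M c.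

Arguments basic_pp M b c : clear implicits.

(** Each intersection is one of its two terms; images compare by left divisibility, kernels by right
    divisibility. *)
Lemma chain_module_total (M : rmodType R) b c b' c' : chain_module M ->
  basic_pp M b c `<=` basic_pp M b' c' \/ basic_pp M b' c' `<=` basic_pp M b c.
Proof.
move=> chM.
have ii x y : act_im M x `<=` act_im M y \/ act_im M y `<=` act_im M x.
  by have [] := uniserial_ldvd uniR x y => -[z ->];
     [right|left]; exact: act_imM.
have kk x y : act_ker M x `<=` act_ker M y \/ act_ker M y `<=` act_ker M x.
  by have [] := uniserial_rdvd uniR x y => -[z ->];
     [left|right]; exact: act_kerM.
rewrite /basic_pp.
have [/setIidl ->|/setIidr ->] := chM b c;
have [/setIidl ->|/setIidr ->] := chM b' c' => //.
exact/or_comm/chM.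
Qed.

(** Reduces to inclusions between single images and kernels, each controlled by one or more of the
    invariants. *)
Lemma same_ideals_basic_pp (M N : rmodType R) b c d e :
  chain_module M -> chain_module N -> same_ideals M N ->
  basic_pp N b c `<=` basic_pp N d e -> basic_pp M b c `<=` basic_pp M d e.
Proof.
move=> chM chN same; have [eA eP eQ _] := same.
have imker s h : act_im N s `<=` act_ker N h -> act_im M s `<=` act_ker M h.
  by move=> /act_im_sub_ker sh; apply/act_im_sub_ker; rewrite eA.
have kerim s h : act_ker N h `<=` act_im N s -> act_ker M h `<=` act_im M s.
  move=> hs; have [sh|//] := chM s h.
  have : exact_at M s h.
    apply: (same_ideals_exact_at chM chN same); apply/seteqP; split=> //.
    by apply/act_im_sub_ker; rewrite -eA; apply/act_im_sub_ker.
  by rewrite /exact_at => ->.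
have imim x y : act_im N x `<=` act_im N y -> act_im M x `<=` act_im M y.
  have [[z ->]|[z ->] _] := uniserial_ldvd uniR x y; last exact: act_imM.
  by move=> /(act_imM_eq chN) h; apply/(act_imM_eq chM); rewrite eA eQ.
have kerker x y : act_ker N x `<=` act_ker N y -> act_ker M x `<=` act_ker M y.
  have [[z ->] _|[z ->]] := uniserial_rdvd uniR x y; first exact: act_kerM.
  by move=> /(act_kerM_eq chN) h; apply/(act_kerM_eq chM); rewrite eA eP.
have split_inter (X : set N) (Y : set M) :
    (act_im N b `<=` X -> act_im M b `<=` Y) ->
    (act_ker N c `<=` X -> act_ker M c `<=` Y) ->
    basic_pp N b c `<=` X -> basic_pp M b c `<=` Y.
  move=> hb hc; rewrite /basic_pp.
  have [/setIidl ->|/setIidr ->] := chN b c.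
    by move=> /hb bY x [/bY].
  by move=> /hc cY x [_ /cY].
rewrite {2}/basic_pp subsetI => -[hd he].
rewrite [X in _ `<=` X]/basic_pp subsetI; split.
  by apply: split_inter hd; [exact: imim|exact: kerim].
by apply: split_inter he; [exact: imker|exact: kerker].
Qed.

(** In a chain module a finite sum of basic pp-subgroups is the largest of them. The coefficients do
    not depend on [M], which allows a comparison of two modules. *)
Lemma pp_sol_subset (phi psi : pp_formula R 1) :
  exists n m (b c : 'I_n -> R) (d e : 'I_m -> R), forall M : rmodType R,
    chain_module M -> (pp_sol phi M `<=` pp_sol psi M <->
      forall i, exists j, basic_pp M (b i) (c i) `<=` basic_pp M (d j) (e j)).
Proof.
have [n [b [c phiE]]] := pp_sol_sum uniR phi.
have [m [d [e psiE]]] := pp_sol_sum uniR psi.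
(* The extra pair [(0, 0)] defines the zero subgroup, so that a largest term exists even if [psi] is
   an empty sum. *)
have [d1 d10 d1l] := ord_extend ord0 0 d.
have [e1 e10 e1l] := ord_extend ord0 0 e.
exists n, m.+1, b, c, d1, e1 => M chM.
have zero x y : basic_pp M x y 0.
  by split; [exists 0; rewrite act0l|rewrite /act_ker /= act0l].
have addB x y u v : basic_pp M x y u -> basic_pp M x y v -> basic_pp M x y (u + v).
  move=> [[u' ->] uy] [[v' ->] vy]; split; first by exists (u' + v'); rewrite actDl.
  by rewrite /act_ker /= actDl uy vy addr0.
split=> [sub i|sub x /phiE[t [tP xE]]].
  have [j jmax] : exists j, forall k,
      basic_pp M (d1 k) (e1 k) `<=` basic_pp M (d1 j) (e1 j).
    apply: (ord_max_elt (le := fun x y : R * R =>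
      basic_pp M x.1 x.2 `<=` basic_pp M y.1 y.2) (fun k => (d1 k, e1 k))).
      by move=> x y; exact: chain_module_total.
    by move=> x y z; exact: subset_trans.
  exists j => x xP; have [t [tP xE]] : exists t : 'I_m -> M,
      (forall k, (act_im M (d k) `&` act_ker M (e k)) (t k)) /\ x = \sum_k t k.
    have /sub/psiE : pp_sol phi M (\row__ x).
      apply/phiE; exists (fun k => if k == i then x else 0); split=> [k|].
        by case: eqP => [->|_]; [exact: xP|exact: zero].
      by rewrite mxE -big_mkcond big_pred1_eq.
    by rewrite mxE.
  rewrite xE; elim/big_ind: _ => [|u v|k _]; [exact: zero|exact: addB|].
  by apply: (jmax (lift ord0 k)); rewrite d1l e1l; exact: tP.
pose S : set M := [set y | exists t : 'I_m -> M,
  (forall k, basic_pp M (d k) (e k) (t k)) /\ y = \sum_k t k].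
have S0 : S 0 by exists (fun=> 0); split=> [k|]; [exact: zero|rewrite big1].
have SD u v : S u -> S v -> S (u + v).
  move=> [tu [tuP ->]] [tv [tvP ->]]; exists (fun k => tu k + tv k).
  by rewrite big_split; split=> // k; exact: addB.
have St i : S (t i).
  have [j /(_ _ (tP i))] := sub i.
  case: (unliftP ord0 j) => [k ->|->]; rewrite ?d1l ?e1l ?d10 ?e10.
    move=> tk; exists (fun k' => if k' == k then t i else 0); split=> [k'|].
      by case: eqP => [->|_]; [exact: tk|exact: zero].
    by rewrite -big_mkcond big_pred1_eq.
  by move=> [[u ->] _]; rewrite act0.
apply/psiE; rewrite xE; change (S (\sum_i t i)).
by elim/big_ind: (\sum_i t i).
Qed.

Lemma same_ideals_pp_sol (M N : rmodType R) (phi psi : pp_formula R 1) :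
  chain_module M -> chain_module N -> same_ideals M N ->
  pp_sol phi N `<=` pp_sol psi N -> pp_sol phi M `<=` pp_sol psi M.
Proof.
have [n [m [b [c [d [e H]]]]]] := pp_sol_subset phi psi.
move=> chM chN same /(H _ chN) sub; apply/(H _ chM) => i.
by have [j] := sub i; exists j; exact: (same_ideals_basic_pp chM chN same).
Qed.

End Invariants.

(** * Finiteness up to indistinguishability *)

Lemma finite_type_fiber (T : Type) (X : finType) (g : T -> X) :
  exists n (f : 'I_n -> T), forall x, exists i, g (f i) = g x.
Proof.
suff [n [f fP]] : exists n (f : 'I_n -> T),
    forall x, g x \in enum X -> exists i, g (f i) = g x.
  by exists n, f => x; apply: fP; rewrite mem_enum.
elim: (enum X) => [|a s [n [f fP]]].
  have F : 'I_0 -> T by case.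
  by exists 0%N, F.
have [[y gy]|ny] := EM (exists y, g y = a).
  have [f1 f10 f1l] := ord_extend ord0 y f.
  exists n.+1, f1 => x; rewrite inE => /orP[/eqP ->|/fP[i <-]].
    by exists ord0; rewrite f10.
  by exists (lift ord0 i); rewrite f1l.
exists n, f => x; rewrite inE => /orP[/eqP gx|/fP //].
by case: ny; exists x.
Qed.

(** The sets that do not separate [C] from [D] form a topology, so it is enough that they include
    the basic sets. *)
Lemma Zg_indistinguishable (R : pzRingType) (C D : Zg R) :
  (forall phi psi, Zg_basic phi psi C <-> Zg_basic phi psi D) ->
  indistinguishable C D.
Proof.
move=> H U oU; apply: (oU (fun V => V C <-> V D)).

  split=> // [V W hV hW|F hF]; first by rewrite hV hW.
  by split=> -[V FV]; exists V => //; apply/(hF _ FV).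
by move=> _ [phi [psi ->]].
Qed.

Theorem mainTheorem5 (R : pzRingType) :
  uniserial R ->
  finite_set [set I : set R | two_sided_ideal I] ->
  finite_type (T0_quotient (Zg R)).
Proof.
move=> uniR finR.
have [n [e eP]] : exists n (e : 'I_n -> set R),
    forall J, two_sided_ideal J -> exists i, e i = J.
  have [n /card_esym/card_set_bijP] := finR.
  move=> [f fbij]; exists n, (fun i => f i) => J JP.
  have [_ _ /(_ J JP)[k kn <-]] := fbij.
  by exists (Ordinal kn).
(* Encodes an ideal by its positions in the list [e], so that invariants take values in a finite
   type. *)
pose key (J : set R) := [ffun i => `[< e i = J >]].
have keyI J J' : two_sided_ideal J -> key J = key J' -> J = J'.
  move=> /eP[i <-] /ffunP/(_ i); rewrite !ffunE.
  by rewrite asboolT // => /esym/asboolP.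
pose inv (N : indec_pinj R) := (key (annihilator N), key (noninjective N),
  key (nonsurjective N), [ffun i => `[< exact_ideals N (e i) >]]).
have chain (N : indec_pinj R) : chain_module N.
  move=> s h; apply: act_im_ker_chain => //; first exact: indec_pinjP.
  exact: indec_pinj_indec.
have exactP (M N : indec_pinj R) : inv M = inv N ->
    exact_ideals M `<=` exact_ideals N.
  case=> _ _ _ /ffunP eD J MJ.
  have [i eJ] : exists i, e i = J.
    have [s [_ [_ _ _ ->]]] := MJ.
    by apply: eP; exact: principal_ideal_two_sided.
  by have := eD i; rewrite !ffunE eJ asboolT // => /esym/asboolP.
have invP (M N : indec_pinj R) : inv M = inv N -> same_ideals M N.
  move=> eMN; have [nzM _] := indec_pinj_indec M.
  have [eA eP' eQ _] := eMN; split.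
  - exact: keyI (annihilator_ideal M) eA.
  - exact: keyI (noninjective_ideal (@chain M) uniR nzM) eP'.
  - exact: keyI (nonsurjective_ideal (@chain M) uniR nzM) eQ.
  - by apply/seteqP; split; exact: exactP.
(* A point is an isomorphism class; it receives the invariants of all its members, without a choice
   of representative. *)
pose inv_set (C : Zg R) := [set x | `[< exists2 N, sval C N & inv N = x >]]%SET.
have inv_setP (C D : Zg R) : inv_set C = inv_set D ->
    forall phi psi, Zg_basic phi psi C -> Zg_basic phi psi D.
  move=> eqCD phi psi [M CM [_ nsub]].
  have : inv M \in inv_set D by rewrite -eqCD inE; apply/asboolP; exists M.
  rewrite inE => /asboolP[N DN eqNM]; exists N => //.
  split=> [x []//|sub]; apply: nsub => x phix; split=> //.
  apply: (same_ideals_pp_sol uniR (chain M) (chain N) (invP _ _ (esym eqNM))) phix.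
  by move=> y /sub[].
have [m [f fP]] := finite_type_fiber inv_set.
exists m, (fun i => to_class (indistinguishable (T:=Zg R)) (f i)).
move=> [W [x Wx]]; have [i fi] := fP x; exists i.
apply: eq_exist; rewrite Wx.
have ind : indistinguishable (f i) x.
  by apply: Zg_indistinguishable => phi psi; split; exact: inv_setP.
apply/funext => y; apply/propext; split=> h U UO.
  by rewrite -(h U UO); apply: iff_sym; exact: ind.
by rewrite (ind U UO); exact: h.
Qed.
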